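(* Let $\widetilde{\mathcal{A}}\in\mathbb{R}^{(I_1+1)\times \dots\times (I_N+1)}$ be the hyperinterpolation coefficient tensor of a function $f$ on $[-1,1]^N$ (defined in the context). For each $n=1,\dots,N$ put $J_n=\prod_{m\neq n}(I_m+1)$ and let $\widetilde{\mathbf{A}}_{(n)}=\mathbf{W}_n\mathbf{\Sigma}_n\mathbf{V}_n^\top$ be an SVD of the mode-$n$ unfolding, where $\mathbf{W}_n\in\mathbb{R}^{(I_n+1)\times (I_n+1)}$ and $\mathbf{V}_n\in \mathbb{R}^{J_n\times J_n}$ are orthogonal and $\mathbf{\Sigma}_n\in\mathbb{R}^{(I_n+1)\times J_n}$ is diagonal with the singular values of $\widetilde{\mathbf{A}}_{(n)}$ in descending order. For each $n$, let $\mathbb{I}_n\subset\{1,\dots,I_n+1\}$ with $|\mathbb{I}_n|=S_n<I_n+1$ and $\mathbb{J}_n\subset\{1,\dots,J_n\}$ with $|\mathbb{J}_n|=S_n'<J_n$. Set $$\mathcal{G}=\widetilde{\mathcal{A}}(\mathbb{I}_1,\dots,\mathbb{I}_N),\qquad \mathbf{C}_n=\widetilde{\mathbf{A}}_{(n)}(:,\mathbb{J}_n),\qquad \mathbf{U}_n=\mathbf{C}_n(\mathbb{I}_n,:),$$ $$\widetilde{\mathcal{A}}_{\rm TCUR}=\mathcal{G}\times_1\left(\mathbf{C}_1\mathbf{U}_1^\dag\right)\times_2\dots\times_N\left(\mathbf{C}_N\mathbf{U}_N^\dag\right).$$ For a given $N$-tuple $(R_1,\dots,R_N)$ with $R_n<\min\{S_n,S_n'\}$,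 let $\widetilde{\mathbf{A}}_{(n),R_n}=\mathbf{W}_{n,R_n}\mathbf{\Sigma}_{n,R_n}\mathbf{V}_{n,R_n}^\top$ be the best rank-$R_n$ approximation to $\widetilde{\mathbf{A}}_{(n)}$, with $\mathbf{W}_{n,R_n}=\mathbf{W}_{n}(:,1:R_n)$, $\mathbf{\Sigma}_{n,R_n}=\mathbf{\Sigma}_{n}(1:R_n,1:R_n)$, $\mathbf{V}_{n,R_n}=\mathbf{V}_{n}(:,1:R_n)$, and set $$\mathbf{W}_{n,R_n,\mathbb{I}_n}=\mathbf{W}_{n,R_n}(\mathbb{I}_n,:),\quad \mathbf{V}_{n,R_n,\mathbb{J}_n}=\mathbf{V}_{n,R_n}(\mathbb{J}_n,:),\quad \Delta_{R_n}=\|\widetilde{\mathbf{A}}_{(n)}-\widetilde{\mathbf{A}}_{(n),R_n}\|_F .$$ Then $$\|\widetilde{\mathcal{A}}-\widetilde{\mathcal{A}}_{\rm TCUR}\|_F\leq\sum_{n=1}^N\left(\prod_{m=1}^{n-1}\|\mathbf{C}_m\mathbf{U}_m^\dag\|_2\right)\left(\alpha_{n,R_n}\Delta_{R_n}+\beta_{n,R_n}\|\mathbf{U}_n^\dag\|_2\Delta_{R_n}^2\right),$$ with $$\alpha_{n,R_n}=\|\mathbf{W}_{n,R_n,\mathbb{I}_n}^\dag\|_2+\|\mathbf{V}_{n,R_n,\mathbb{J}_n}^\dag\|_2+3\|\mathbf{W}_{n,R_n,\mathbb{I}_n}^\dag\|_2\|\mathbf{V}_{n,R_n,\mathbb{J}_n}^\dag\|_2+1,$$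 $$\beta_{n,R_n}=\|\mathbf{W}_{n,R_n,\mathbb{I}_n}^\dag\|_2+\|\mathbf{V}_{n,R_n,\mathbb{J}_n}^\dag\|_2+\|\mathbf{W}_{n,R_n,\mathbb{I}_n}^\dag\|_2\|\mathbf{V}_{n,R_n,\mathbb{J}_n}^\dag\|_2+1.$$
   Context: Hyperinterpolation coefficient tensor. For each $n=1,\dots,N$ let $w_n$ be a weight function on $[-1,1]$ and let $\{\Phi^{(n)}_{i}\}_{i\ge 1}$ be the orthonormal polynomials for the inner product $\int_{-1}^1 g h\,w_n\,dx$, with $\Phi^{(n)}_i$ of degree $i-1$. Let $I_n$ be a given polynomial degree, and let $\{x^{(n)}_{m}\}_{m=1}^{M_n}\subset[-1,1]$ and $\{w^{(n)}_m\}_{m=1}^{M_n}$ be the nodes and positive weights of a quadrature rule that integrates exactly against $w_n$ all polynomials of degree at most $2I_n$. For $1\le i_n\le I_n+1$, $$\widetilde a_{i_1\dots i_N}=\sum_{m_1=1}^{M_1}\dots\sum_{m_N=1}^{M_N} f(x^{(1)}_{m_1},\dots,x^{(N)}_{m_N})\,\Phi^{(1)}_{i_1}(x^{(1)}_{m_1})\cdots\Phi^{(N)}_{i_N}(x^{(N)}_{m_N})\,w^{(1)}_{m_1}\cdots w^{(N)}_{m_N},$$ and $\widetilde{\mathcal{A}}=[\widetilde a_{i_1\dots i_N}]$. Notation. The mode-$n$ unfolding $\widetilde{\mathbf{A}}_{(n)}\in\mathbb{R}^{(I_n+1)\times J_n}$ has rows indexed by $i_n$ and columns indexed by the other indices $(i_m)_{m\ne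 n}$ (linearly ordered with lower modes varying fastest). $\mathcal{G}\times_n\mathbf{M}$ is the mode-$n$ tensor-matrix product. $\mathbf{A}(\mathbb{I},:)$, $\mathbf{A}(:,\mathbb{J})$, $\widetilde{\mathcal{A}}(\mathbb{I}_1,\dots,\mathbb{I}_N)$ denote restriction to the given index sets. $\dag$ is the Moore–Penrose pseudoinverse, $\|\cdot\|_2$ the spectral norm, $\|\cdot\|_F$ the Frobenius norm. Empty products equal $1$. Two variants are covered: Chidori-type, where $\mathbb{J}_n$ is the set of columns with $i_m\in\mathbb{I}_m$ for all $m\ne n$ (so $\mathbf{C}_n$ is the mode-$n$ unfolding of $\widetilde{\mathcal{A}}(\mathbb{I}_1,\dots,\mathbb{I}_{n-1},:,\mathbb{I}_{n+1},\dots,\mathbb{I}_N)$), and Fiber-type, where $\mathbb{J}_n$ is an arbitrary subset of the columns.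
   Formalization: The formal theorem additionally assumes that W_{n,R_n,I_n} and V_{n,R_n,J_n} have full column rank R_n for every n; without this the bound fails (N=2, f=1, Legendre weight, I_n=3, both index sets {2,3}, R_n=1: left side 2, right side 0). *)

(* Defs.v *)
From HB Require Import structures.
From mathcomp Require Import all_boot all_order all_algebra.
From mathcomp Require Import all_classical all_reals all_analysis.

Set Implicit Arguments.
Unset Strict Implicit.
Unset Printing Implicit Defensive.

Import Order.TTheory GRing.Theory Num.Theory.

Local Open Scope classical_set_scope.
Local Open Scope ring_scope.

Section OrthogonalPolynomials.
Variable R : realType.
Local Notation mu := (@lebesgue_measure R).

Definition weight_function (w : R -> R) : Prop :=
  [/\ forall t, t \in `[(-1 : R), 1] -> 0 <= w t,
      mu.-integrable `[(-1 : R), 1] (EFin \o w)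
    & 0 < \int[mu]_(t in `[(-1 : R), 1]) w t].

Definition weighted_dot (w : R -> R) (g h : {poly R}) : R :=
  \int[mu]_(t in `[(-1 : R), 1]) (g.[t] * h.[t] * w t).

(* Polynomials are numbered from 0: [Phi k] has degree k (its [size] is k.+1)
   and is the polynomial usually numbered k+1. *)
Definition orthonormal_polys (w : R -> R) (Phi : nat -> {poly R}) : Prop :=
  (forall k, size (Phi k) = k.+1) /\
  (forall k l, weighted_dot w (Phi k) (Phi l) = (k == l)%:R).

Definition quadrature_rule (w : R -> R) (deg M : nat) (x omega : 'I_M -> R) :
    Prop :=
  [/\ forall m, x m \in `[(-1 : R), 1],
      forall m, 0 < omega m
    & forall p : {poly R}, (size p <= deg.+1)%N ->
        \sum_(m < M) p.[x m] * omega m =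
        \int[mu]_(t in `[(-1 : R), 1]) (p.[t] * w t)].

End OrthogonalPolynomials.

Section Matrices.
Variable R : realType.

Definition fnorm m n (A : 'M[R]_(m, n)) : R :=
  Num.sqrt (\sum_i \sum_j A i j ^+ 2).

(* Operator norm for the Euclidean norms; [fnorm] of a column vector is its
   Euclidean norm. *)
Definition spectral_norm m n (A : 'M[R]_(m, n)) : R :=
  sup [set fnorm (A *m v) | v in [set v : 'cV[R]_n | fnorm v <= 1]].

Definition penrose m n (A : 'M[R]_(m, n)) (X : 'M[R]_(n, m)) : Prop :=
  [/\ A *m X *m A = A, X *m A *m X = X,
      (A *m X)^T = A *m X & (X *m A)^T = X *m A].

(* Moore-Penrose pseudoinverse; see [mpinvP] and [penrose_unique]. *)
Definition mpinv m n (A : 'M[R]_(m, n)) : 'M[R]_(n, m) :=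
  xget 0 [set X | penrose A X].

Lemma row_free_gram m n (B : 'M[R]_(m, n)) :
  row_free B -> B *m B^T \in unitmx.
Proof.
move=> Bf; rewrite -row_free_unit; apply: inj_row_free => v vBB.
apply: (row_free_inj Bf); rewrite mul0mx.
have : (v *m B) *m (v *m B)^T = 0.
  by rewrite trmx_mul !mulmxA -(mulmxA v) vBB mul0mx.
move: (v *m B) => u /matrixP/(_ 0 0); rewrite !mxE => /eqP.
rewrite psumr_eq0 => [/allP u0|i _]; last by rewrite mxE -expr2 sqr_ge0.
apply/rowP => j; have := u0 j (mem_index_enum _).
by rewrite !mxE mulf_eq0 orbb => /eqP.
Qed.

Lemma penrose_unique m n (A : 'M[R]_(m, n)) (X Y : 'M[R]_(n, m)) :
  penrose A X -> penrose A Y -> X = Y.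
Proof.
move=> [X1 X2 X3 X4] [Y1 Y2 Y3 Y4].
have AXY : A *m X = A *m Y.
  by rewrite -X3 -{1}Y1 -(mulmxA (A *m Y)) trmx_mul X3 Y3 mulmxA X1.
have XYA : X *m A = Y *m A.
  by rewrite -X4 -{1}Y1 -(mulmxA A) mulmxA trmx_mul X4 Y4 -mulmxA (mulmxA A) X1.
by rewrite -X2 XYA -mulmxA AXY mulmxA Y2.
Qed.

Lemma mpinvP m n (A : 'M[R]_(m, n)) : penrose A (mpinv A).
Proof.
apply: (@xgetPex _ 0 [set X | penrose A X]).
have [r [C [B [-> Bf Cf]]]] : exists r (C : 'M[R]_(m, r)) (B : 'M[R]_(r, n)),
    [/\ A = C *m B, row_free B & row_free C^T].
  exists (\rank A), (col_base A), (row_base A).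
  split; rewrite ?mulmx_base ?row_base_free//.
  by rewrite /row_free mxrank_tr; apply: col_base_full.
have Bu := row_free_gram Bf.
have := row_free_gram Cf; rewrite trmxK => Cu.
pose P := invmx (B *m B^T); pose Q := invmx (C^T *m C).
pose X := B^T *m P *m (Q *m C^T).
have AX : C *m B *m X = C *m Q *m C^T.
  by rewrite /X !mulmxA -(mulmxA C B) -(mulmxA C _ P) mulmxV // mulmx1.
have XA : X *m (C *m B) = B^T *m P *m B.
  by rewrite /X -!mulmxA; do 2!congr (_ *m _);
     rewrite !mulmxA -(mulmxA Q) mulVmx // mul1mx.
have Pt : P^T = P by rewrite /P trmx_inv trmx_mul trmxK.
have Qt : Q^T = Q by rewrite /Q trmx_inv trmx_mul trmxK.
exists X; split.
- by rewrite AX !mulmxA -(mulmxA _ C^T) -(mulmxA C) mulVmx // mulmx1.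
- by rewrite XA /X !mulmxA -(mulmxA _ B) -(mulmxA _ _ P) mulmxV // mulmx1.
- by rewrite AX !trmx_mul trmxK Qt !mulmxA.
- by rewrite XA !trmx_mul trmxK Pt !mulmxA.
Qed.

Definition orthogonal_mx n (Q : 'M[R]_n) : Prop := Q^T *m Q = 1%:M.

Definition is_svd m n (A : 'M[R]_(m, n)) (W : 'M[R]_m) (S : 'M[R]_(m, n))
    (V : 'M[R]_n) : Prop :=
  [/\ A = W *m S *m V^T, orthogonal_mx W, orthogonal_mx V, is_diag_mx S
    & (forall i j, 0 <= S i j) /\
      (forall (i i' : 'I_m) (j j' : 'I_n), i = j :> nat -> i' = j' :> nat ->
         (i <= i')%N -> S i' j' <= S i j)].

Definition rows_of m n (I : {set 'I_m}) (A : 'M[R]_(m, n)) : 'M[R]_(#|I|, n) :=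
  rowsub (fun k : 'I_#|I| => enum_val k) A.

Definition cols_of m n (J : {set 'I_n}) (A : 'M[R]_(m, n)) : 'M[R]_(m, #|J|) :=
  colsub (fun k : 'I_#|J| => enum_val k) A.

Definition first_cols m n r (h : (r <= n)%N) (A : 'M[R]_(m, n)) :
    'M[R]_(m, r) :=
  colsub (widen_ord h) A.

Definition leading_block m n r (hm : (r <= m)%N) (hn : (r <= n)%N)
    (A : 'M[R]_(m, n)) : 'M[R]_r :=
  mxsub (widen_ord hm) (widen_ord hn) A.

End Matrices.

Lemma ltn_min_card_l m n (I : {set 'I_m}) (J : {set 'I_n}) r :
  (r < minn #|I| #|J|)%N -> (r <= m)%N.
Proof.
rewrite leq_min => /andP[/ltnW rI _]; apply: leq_trans rI _.
by rewrite -[leqRHS]card_ord max_card.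
Qed.

Lemma ltn_min_card_r m n (I : {set 'I_m}) (J : {set 'I_n}) r :
  (r < minn #|I| #|J|)%N -> (r <= n)%N.
Proof. by rewrite minnC; apply: ltn_min_card_l. Qed.

Section Tensors.
Variables (R : realType) (N : nat).

Definition mindex (d : 'I_N -> nat) : finType := {dffun forall n, 'I_(d n)}.

Definition tensor (d : 'I_N -> nat) := {ffun mindex d -> R}.

Definition tnorm d (T : tensor d) : R := Num.sqrt (\sum_i T i ^+ 2).

Definition subtensor d (I : forall n, {set 'I_(d n)}) (T : tensor d) :
    tensor (fun n => #|I n|) :=
  [ffun k : mindex (fun n => #|I n|) =>
     T [ffun n => @enum_val _ (mem (I n)) (k n)]].

(* Tensors of varying sizes are handled as arrays on all of nat^N, extended by
   zero outside of their index box. *)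
Definition array := ('I_N -> nat) -> R.

Definition array_of d (T : tensor d) : array :=
  fun i => \sum_(k : mindex d | [forall n, k n == i n :> nat]) T k.

Definition tensor_of d (T : array) : tensor d :=
  [ffun k : mindex d => T (fun n => k n)].

Definition set_coord (n : 'I_N) (l : nat) (i : 'I_N -> nat) : 'I_N -> nat :=
  fun m => if m == n then l else i m.

(* The outer sum has a single term when [i n < p] and is empty otherwise. *)
Definition modeprod (n : 'I_N) p q (T : array) (A : 'M[R]_(p, q)) : array :=
  fun i => \sum_(s < p | s == i n :> nat)
             \sum_(l < q) T (set_coord n l i) * A s l.

Definition modeprods (p q : 'I_N -> nat) (T : tensor q)
    (A : forall n, 'M[R]_(p n, q n)) : tensor p :=
  tensor_of p (foldl (fun T' n => modeprod n T' (A n)) (array_of T) (enum 'I_N)).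

(* The usual entrywise formula for successive mode products. *)
Lemma modeprodsE (p q : 'I_N -> nat) (T : tensor q)
    (A : forall n, 'M[R]_(p n, q n)) (i : mindex p) :
  modeprods T A i = \sum_(k : mindex q) T k * \prod_n A n (i n) (k n).
Proof.
pose g n (a : nat) (b : 'I_(q n)) := \sum_(s < p n | s == a :> nat) A n s b.
have gen s (j : 'I_N -> nat) : uniq s ->
    foldl (fun T' n => modeprod n T' (A n)) (array_of T) s j =
    \sum_(k : mindex q | [forall n, (n \notin s) ==> (k n == j n :> nat)])
       T k * \prod_(n <- s) g n (j n) (k n).
  elim/last_ind: s j => [|s n IH] j.
    by move=> _; apply: eq_big => [k|k _]; rewrite ?big_nil ?mulr1.
  rewrite rcons_uniq => /andP[nNs us]; rewrite foldl_rcons /modeprod.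
  rewrite exchange_big /=.
  under eq_bigr => l _ do rewrite -mulr_sumr -/(g n (j n) l) IH // mulr_suml.
  rewrite (partition_big (fun k : mindex q => k n) xpredT) //=.
  apply: eq_bigr => l _; apply: eq_big => [k|k /forallP kl].
    apply/forallP/andP => [kl|[/forallP kj /eqP <-] m]; last first.
      apply/implyP => ms; rewrite /set_coord; case: (eqVneq m n) => [->//|mn].
      by have /implyP kjm := kj m; apply: kjm; rewrite mem_rcons inE negb_or mn.
    split; last by have := kl n; rewrite nNs /set_coord eqxx /= => /eqP kn; apply/eqP/val_inj.
    apply/forallP => m; rewrite mem_rcons inE negb_or; apply/implyP => /andP[mn ms].
    by have := kl m; rewrite ms /set_coord (negPf mn).
  have kn : k n = l by have := kl n; rewrite nNs /set_coord eqxx /= => /eqP /val_inj.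
  rewrite -mulrA; congr (_ * _); rewrite -cats1 big_cat big_seq1 kn.
  congr (_ * _); rewrite big_seq [RHS]big_seq; apply: eq_bigr => m ms.
  by rewrite /set_coord; case: (eqVneq m n) => // mn; rewrite -mn ms in nNs.
rewrite /modeprods ffunE gen ?enum_uniq//; apply: eq_big => [k|k _].
  by apply/forallP => m; rewrite mem_enum.
rewrite big_enum /=; congr (_ * _); apply: eq_bigr => n _.
by rewrite /g (big_pred1 (i n)).
Qed.

End Tensors.

Section Unfolding.
Variables (R : realType) (N : nat) (d : 'I_N -> nat).

Definition unfold_cols (n : 'I_N) : nat := \prod_(m < N | m != n) (d m).+1.

(* Column j of the mode-n unfolding corresponds to the mixed-radix digits of j
   in the bases (d m).+1, m != n, lower modes varying fastest; [inZp] reduces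
   modulo (d m).+1. *)
Definition unfold_stride (n m : 'I_N) : nat :=
  \prod_(k < N | (k < m)%N && (k != n)) (d k).+1.

Definition unfold_index (n : 'I_N) (i : 'I_(d n).+1) (j : nat) :
    mindex (fun m => (d m).+1) :=
  [ffun m => @dfwith _ (fun m => 'I_(d m).+1)
     (fun m => inZp (j %/ unfold_stride n m)) n i m].

Definition unfold (n : 'I_N) (T : tensor R (fun m => (d m).+1)) :
    'M[R]_((d n).+1, unfold_cols n) :=
  \matrix_(i, j) T (unfold_index i j).

Definition hyper_coef (Phi : 'I_N -> nat -> {poly R}) (M : 'I_N -> nat)
    (x omega : forall n, 'I_(M n) -> R) (f : 'rV[R]_N -> R) :
    tensor R (fun n => (d n).+1) :=
  [ffun i : mindex (fun n => (d n).+1) =>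
     \sum_(m : mindex M)
       f (\row_n x n (m n)) * (\prod_n (Phi n (i n)).[x n (m n)])
         * \prod_n omega n (m n)].

End Unfolding.

(* Main.v *)
Require Import Defs.
From mathcomp Require Import all_boot all_order all_algebra.
From mathcomp Require Import all_classical all_reals all_analysis.
From mathcomp Require Import ring.

Set Implicit Arguments.
Unset Strict Implicit.
Unset Printing Implicit Defensive.

Import Order.TTheory GRing.Theory Num.Theory.

Local Open Scope ring_scope.

(** The error is estimated one mode at a time. Restricting the tensor [A] to
    the index sets and then multiplying by the [C n *m mpinv (U n)] amounts to
    multiplying [A] along every mode [n] by one square matrix
    [B n = C n *m mpinv (U n) *m P n], where [P n] selects the rows in [I n]
    ([subtensorE], [modeprods_comp]). Replacing the identity by [B n] in modes
    0, 1, ... successively gives a telescoping sum: its n-th term is the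
    residual of mode n alone, multiplied by the [B m] with [m < n]. A product
    along one mode is a matrix product on that mode's unfolding, and unfolding
    preserves the Frobenius norm because it merely relabels entries; so each
    earlier mode costs a factor [spectral_norm (B m)], which is at most
    [spectral_norm (C m *m mpinv (U m))] ([tnorm_sub_modeprods]).

    What remains is a statement on a single matrix, [cur_error]: bound
    [A - A Q U^+ P A] for [U = P A Q], where [P] and [Q] select rows and
    columns. Write [A = W S V^T + E] with [W S V^T] the truncated
    decomposition. Since [P W] has full column rank, [L = W (P W)^+] recovers
    [W S V^T] from its selected rows, and likewise [K = ((Q^T V)^+)^T V^T] from
    its selected columns. Hence, with [F = P E Q],
      [A Q = L U + E1],  [P A = U K + E2],  [A = L U K + E - L F K],
    where [E1 = E Q - L F] and [E2 = P E - F K] are of the order of [E].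
    As [U U^+ U = U], the terms without error cancel:
      [A - A Q U^+ P A
         = E - L F K - L (U U^+) E2 - E1 (U^+ U) K - E1 U^+ E2].
    [U U^+] and [U^+ U] are orthogonal projections, so only the last term sees
    the norm of [U^+], and it is quadratic in [E]. Adding up the five norms
    gives the two coefficients of the bound. *)

(** * The Euclidean norm of a finite family *)

Section EuclideanNorm.
Variable R : realType.

(** Matrices and tensors are families over different finite types; this is the
    common form of [fnorm] and [tnorm], so that the Cauchy-Schwarz and triangle
    inequalities are proved once. *)
Definition l2norm (T : finType) (u : T -> R) : R := Num.sqrt (\sum_i u i ^+ 2).

Lemma sum_sqr_ge0 (T : finType) (u : T -> R) : 0 <= \sum_i u i ^+ 2.
Proof. by apply: sumr_ge0 => i _; apply: sqr_ge0. Qed.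

Lemma l2norm_ge0 (T : finType) (u : T -> R) : 0 <= l2norm u.
Proof. exact: sqrtr_ge0. Qed.

Lemma l2norm_sqr (T : finType) (u : T -> R) : l2norm u ^+ 2 = \sum_i u i ^+ 2.
Proof. by rewrite sqr_sqrtr ?sum_sqr_ge0. Qed.

(** Lagrange's identity: the defect in the squared inequality is half of the sum
    of the squares of all the 2 by 2 minors of [u] and [v]. *)
Lemma cauchy_schwarz (T : finType) (u v : T -> R) :
  \sum_i u i * v i <= l2norm u * l2norm v.
Proof.
apply: le_trans (ler_norm _) _.
rewrite -(ler_pXn2r (n := 2)) ?nnegrE ?mulr_ge0 ?l2norm_ge0//.
rewrite real_normK ?num_real// exprMn !l2norm_sqr -subr_ge0.
have lagrange : 0 <= \sum_i \sum_j (u i * v j - u j * v i) ^+ 2.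
  by do 2![apply: sumr_ge0 => ? _]; apply: sqr_ge0.
suff -> : (\sum_i u i ^+ 2) * (\sum_i v i ^+ 2) - (\sum_i u i * v i) ^+ 2 =
    (\sum_i \sum_j (u i * v j - u j * v i) ^+ 2) / 2 by rewrite divr_ge0.
pose a := \sum_i u i ^+ 2; pose b := \sum_i v i ^+ 2.
pose c := \sum_i u i * v i.
have -> : \sum_i \sum_j (u i * v j - u j * v i) ^+ 2 =
    a * b + b * a - 2 * c * c.
  transitivity (\sum_i (u i ^+ 2 * b + v i ^+ 2 * a - 2 * c * (u i * v i))).
    apply: eq_bigr => i _.
    have -> : 2 * c * (u i * v i) = (2 * (u i * v i)) * c by ring.
    rewrite /a /b /c !mulr_sumr -big_split -sumrB /=.
    by apply: eq_bigr => j _; ring.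
  by rewrite sumrB big_split /= -!mulr_suml -mulr_sumr mulrC.
by rewrite -/a -/b -/c; field.
Qed.

Lemma l2norm_triangle (T : finType) (u v : T -> R) :
  l2norm (fun i => u i + v i) <= l2norm u + l2norm v.
Proof.
rewrite -(ler_pXn2r (n := 2)) ?nnegrE ?addr_ge0 ?l2norm_ge0//.
rewrite sqrrD !l2norm_sqr.
under eq_bigr => i _ do rewrite sqrrD.
rewrite !big_split /= lerD2r lerD2l mulr2n.
by apply: lerD; apply: cauchy_schwarz.
Qed.

Lemma l2norm_opp (T : finType) (u : T -> R) :
  l2norm (fun i => - u i) = l2norm u.
Proof. by rewrite /l2norm; under eq_bigr do rewrite sqrrN. Qed.

End EuclideanNorm.

(** * Frobenius and spectral norms of matrices *)

Section MatrixNorms.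
Variable R : realType.

Lemma fnormE m n (A : 'M[R]_(m, n)) : fnorm A = l2norm (fun p => A p.1 p.2).
Proof. by rewrite /fnorm pair_big. Qed.

Lemma fnorm_ge0 m n (A : 'M[R]_(m, n)) : 0 <= fnorm A.
Proof. exact: sqrtr_ge0. Qed.

Lemma fnorm_sqr m n (A : 'M[R]_(m, n)) :
  fnorm A ^+ 2 = \sum_i \sum_j A i j ^+ 2.
Proof. by rewrite fnormE l2norm_sqr pair_big. Qed.

Lemma fnormD m n (A B : 'M[R]_(m, n)) : fnorm (A + B) <= fnorm A + fnorm B.
Proof.
rewrite !fnormE; apply: le_trans (l2norm_triangle _ _).
by rewrite /l2norm; under eq_bigr do rewrite mxE.
Qed.

Lemma fnormN m n (A : 'M[R]_(m, n)) : fnorm (- A) = fnorm A.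
Proof.
rewrite /fnorm; congr Num.sqrt; apply: eq_bigr => i _; apply: eq_bigr => j _.
by rewrite mxE sqrrN.
Qed.

Lemma fnormB m n (A B : 'M[R]_(m, n)) : fnorm (A - B) <= fnorm A + fnorm B.
Proof. by rewrite -(fnormN B) fnormD. Qed.

Lemma fnormZ m n a (A : 'M[R]_(m, n)) : fnorm (a *: A) = `|a| * fnorm A.
Proof.
rewrite /fnorm -(sqrtr_sqr a) -sqrtrM ?sqr_ge0// mulr_sumr; congr Num.sqrt.
apply: eq_bigr => i _; rewrite mulr_sumr; apply: eq_bigr => j _.
by rewrite mxE exprMn.
Qed.

Lemma fnorm0 m n : fnorm (0 : 'M[R]_(m, n)) = 0.
Proof. by rewrite -(scale0r 0) fnormZ normr0 mul0r. Qed.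

Lemma fnorm_eq0 m n (A : 'M[R]_(m, n)) : fnorm A = 0 -> A = 0.
Proof.
move=> A0; have /eqP := fnorm_sqr A; rewrite A0 expr0n /= eq_sym pair_big /=.
rewrite psumr_eq0 => [/allP z|p _]; last exact: sqr_ge0.
apply/matrixP => i j; have := z (i, j) (mem_index_enum _).
by rewrite sqrf_eq0 mxE => /eqP.
Qed.

Lemma fnorm_tr m n (A : 'M[R]_(m, n)) : fnorm A^T = fnorm A.
Proof.
rewrite /fnorm exchange_big; congr Num.sqrt.
by apply: eq_bigr => i _; apply: eq_bigr => j _; rewrite mxE.
Qed.

Lemma dot_le m (u v : 'cV[R]_m) : (u^T *m v) 0 0 <= fnorm u * fnorm v.
Proof.
rewrite !mxE; under eq_bigr do rewrite mxE.
apply: le_trans (cauchy_schwarz _ _) _.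
suff vE (z : 'cV[R]_m) : l2norm (z^~ 0) = fnorm z by rewrite !vE.
by rewrite /fnorm; under [in RHS]eq_bigr do rewrite big_ord1.
Qed.

Lemma dot_sqr m (u : 'cV[R]_m) : (u^T *m u) 0 0 = fnorm u ^+ 2.
Proof.
by rewrite fnorm_sqr !mxE; apply: eq_bigr => i _; rewrite big_ord1 mxE expr2.
Qed.

Lemma fnorm_mulmx m n p (A : 'M[R]_(m, n)) (B : 'M[R]_(n, p)) :
  fnorm (A *m B) <= fnorm A * fnorm B.
Proof.
rewrite -(ler_pXn2r (n := 2)) ?nnegrE ?mulr_ge0 ?fnorm_ge0//.
rewrite exprMn -(fnorm_tr B) !fnorm_sqr mulr_suml.
apply: ler_sum => i _; rewrite mulr_sumr; apply: ler_sum => j _.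
(* The absolute value of an entry is bounded by applying Cauchy-Schwarz to a row
   of [A] and to its opposite. *)
have /= := cauchy_schwarz (fun k => A i k) (fun k => B k j).
have /= := cauchy_schwarz (fun k => - A i k) (fun k => B k j).
under eq_bigr do rewrite mulNr; rewrite sumrN l2norm_opp mxE => h1 h2.
have -> : \sum_j0 B^T j j0 ^+ 2 = l2norm (fun k => B k j) ^+ 2.
  by rewrite l2norm_sqr; under eq_bigr do rewrite mxE.
rewrite -l2norm_sqr -exprMn -real_normK ?num_real//.
by rewrite ler_pXn2r ?nnegrE ?mulr_ge0 ?l2norm_ge0// ler_norml h2 lerNl h1.
Qed.

(** The supremum defining [spectral_norm] is meaningless unless its set is
    bounded; the Frobenius norm is a bound. *)
Lemma spectral_has_sup m n (A : 'M[R]_(m, n)) :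
  has_sup [set fnorm (A *m v) | v in [set v : 'cV[R]_n | fnorm v <= 1]]%classic.
Proof.
split; first by exists (fnorm (A *m (0 : 'cV_n))), 0; rewrite //= fnorm0.
exists (fnorm A) => _ [v /= v1 <-]; apply: le_trans (fnorm_mulmx _ _) _.
by rewrite ler_piMr ?fnorm_ge0.
Qed.

Lemma spectral_norm_ge0 m n (A : 'M[R]_(m, n)) : 0 <= spectral_norm A.
Proof.
have [_ ub] := spectral_has_sup A.
by apply: ub_le_sup => //; exists 0; rewrite /= ?mulmx0 fnorm0.
Qed.

(** The definition only tests vectors of norm at most 1; other ones are reached
    by homogeneity. *)
Lemma spectral_norm_mulv m n (A : 'M[R]_(m, n)) (v : 'cV[R]_n) :
  fnorm (A *m v) <= spectral_norm A * fnorm v.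
Proof.
have [v0|v0] := eqVneq (fnorm v) 0.
  by rewrite v0 mulr0 (fnorm_eq0 v0) mulmx0 fnorm0.
have vgt0 : 0 < fnorm v by rewrite lt_def v0 fnorm_ge0.
rewrite -ler_pdivrMr// mulrC -[X in X * _]ger0_norm ?invr_ge0 ?fnorm_ge0//.
rewrite -fnormZ scalemxAr; have [_ ub] := spectral_has_sup A.
apply: ub_le_sup => //; exists ((fnorm v)^-1 *: v) => //=.
by rewrite fnormZ ger0_norm ?invr_ge0 ?fnorm_ge0// mulVf.
Qed.

Lemma spectral_norm_le m n (A : 'M[R]_(m, n)) c :
  0 <= c -> (forall v : 'cV[R]_n, fnorm (A *m v) <= c * fnorm v) ->
  spectral_norm A <= c.
Proof.
move=> c0 Ac; have [ne _] := spectral_has_sup A.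
apply: ge_sup => // _ [v /= v1 <-]; apply: le_trans (Ac v) _.
by rewrite ler_piMr.
Qed.

Lemma spectral_normM m n p (A : 'M[R]_(m, n)) (B : 'M[R]_(n, p)) :
  spectral_norm (A *m B) <= spectral_norm A * spectral_norm B.
Proof.
apply: spectral_norm_le => [|v]; first by rewrite mulr_ge0 ?spectral_norm_ge0.
rewrite -mulmxA; apply: le_trans (spectral_norm_mulv _ _) _.
by rewrite -mulrA ler_wpM2l ?spectral_norm_ge0 ?spectral_norm_mulv.
Qed.

Lemma le_sqr_cancel (a c : R) : 0 <= a -> 0 <= c -> a ^+ 2 <= c * a -> a <= c.
Proof.
move=> a0 c0; have [->//|an0] := eqVneq a 0.
by rewrite expr2 ler_pM2r // lt_def an0.
Qed.

(** [|A^T v|^2 = <A A^T v, v> <= |A| |A^T v| |v|], then cancel [|A^T v|]. *)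
Lemma spectral_norm_tr_le m n (A : 'M[R]_(m, n)) :
  spectral_norm A^T <= spectral_norm A.
Proof.
apply: spectral_norm_le => [|v]; first exact: spectral_norm_ge0.
apply: le_sqr_cancel; rewrite ?mulr_ge0 ?fnorm_ge0 ?spectral_norm_ge0//.
rewrite -dot_sqr trmx_mul trmxK -mulmxA.
apply: le_trans (dot_le _ _) _; rewrite mulrAC mulrC.
by rewrite ler_wpM2r ?fnorm_ge0 ?spectral_norm_mulv.
Qed.

Lemma spectral_norm_tr m n (A : 'M[R]_(m, n)) :
  spectral_norm A^T = spectral_norm A.
Proof.
apply/eqP; rewrite eq_le spectral_norm_tr_le /=.
by rewrite -[in leLHS](trmxK A) spectral_norm_tr_le.
Qed.

Lemma fnorm_sqr_col m n (A : 'M[R]_(m, n)) :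
  fnorm A ^+ 2 = \sum_j fnorm (col j A) ^+ 2.
Proof.
rewrite fnorm_sqr exchange_big; apply: eq_bigr => j _.
by rewrite fnorm_sqr; apply: eq_bigr => i _; rewrite big_ord1 mxE.
Qed.

(** The squared Frobenius norm is the sum over the columns, and [A] acts on each
    column separately. *)
Lemma fnorm_mull m n p (A : 'M[R]_(m, n)) (B : 'M[R]_(n, p)) :
  fnorm (A *m B) <= spectral_norm A * fnorm B.
Proof.
rewrite -(ler_pXn2r (n := 2)) ?nnegrE ?mulr_ge0 ?fnorm_ge0 ?spectral_norm_ge0//.
rewrite exprMn !fnorm_sqr_col mulr_sumr; apply: ler_sum => j _.
rewrite -exprMn ler_pXn2r ?nnegrE ?mulr_ge0 ?fnorm_ge0 ?spectral_norm_ge0//.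
by rewrite colE -mulmxA -colE spectral_norm_mulv.
Qed.

Lemma fnorm_mulr m n p (A : 'M[R]_(m, n)) (B : 'M[R]_(n, p)) :
  fnorm (A *m B) <= fnorm A * spectral_norm B.
Proof.
rewrite -(fnorm_tr A) -spectral_norm_tr -fnorm_tr trmx_mul mulrC.
exact: fnorm_mull.
Qed.

Lemma spectral_norm_isometry m n (A : 'M[R]_(m, n)) :
  A^T *m A = 1%:M -> spectral_norm A <= 1.
Proof.
move=> AA; apply: spectral_norm_le => // v; rewrite mul1r.
rewrite -(ler_pXn2r (n := 2)) ?nnegrE ?fnorm_ge0// -!dot_sqr.
by rewrite trmx_mul mulmxA -(mulmxA v^T) AA mulmx1.
Qed.

(** For an orthogonal projection, [|A v|^2 = <A v, v> <= |A v| |v|]. *)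
Lemma spectral_norm_proj n (A : 'M[R]_n) :
  A^T = A -> A *m A = A -> spectral_norm A <= 1.
Proof.
move=> At AA; apply: spectral_norm_le => // v; rewrite mul1r.
apply: le_sqr_cancel; rewrite ?fnorm_ge0//.
rewrite -dot_sqr trmx_mul At -mulmxA (mulmxA A) AA mulrC.
have := dot_le (A *m v) v.
by rewrite trmx_mul At mulmxA mulrC.
Qed.

End MatrixNorms.

(** * The error of a matrix CUR decomposition *)

Section CURError.
Variable R : realType.

Lemma fnormB_le m n (A B : 'M[R]_(m, n)) a b :
  fnorm A <= a -> fnorm B <= b -> fnorm (A - B) <= a + b.
Proof. by move=> Aa Bb; apply: le_trans (fnormB _ _) _; apply: lerD. Qed.

Lemma fnorm_mull_le m n p (A : 'M[R]_(m, n)) (B : 'M[R]_(n, p)) a b :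
  spectral_norm A <= a -> fnorm B <= b -> fnorm (A *m B) <= a * b.
Proof.
move=> Aa Bb; apply: le_trans (fnorm_mull _ _) _.
by rewrite ler_pM ?spectral_norm_ge0 ?fnorm_ge0.
Qed.

Lemma fnorm_mulr_le m n p (A : 'M[R]_(m, n)) (B : 'M[R]_(n, p)) a b :
  fnorm A <= a -> spectral_norm B <= b -> fnorm (A *m B) <= a * b.
Proof.
move=> Aa Bb; apply: le_trans (fnorm_mulr _ _) _.
by rewrite ler_pM ?spectral_norm_ge0 ?fnorm_ge0.
Qed.

Lemma spectral_normM_le m n p (A : 'M[R]_(m, n)) (B : 'M[R]_(n, p)) a b :
  spectral_norm A <= a -> spectral_norm B <= b ->
  spectral_norm (A *m B) <= a * b.
Proof.
move=> Aa Bb; apply: le_trans (spectral_normM _ _) _.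
by rewrite ler_pM ?spectral_norm_ge0.
Qed.

(** A left inverse of [A] can be cancelled from [A X A = A]. *)
Lemma mpinv_mul_full m n (A : 'M[R]_(m, n)) :
  row_full A -> mpinv A *m A = 1%:M.
Proof.
move=> /row_fullP[B BA]; have [AXA _ _ _] := mpinvP A.
by rewrite -[LHS]mul1mx -BA -mulmxA (mulmxA A) AXA.
Qed.

Lemma spectral_norm_mpinvr m n (A : 'M[R]_(m, n)) :
  spectral_norm (A *m mpinv A) <= 1.
Proof.
have [AXA _ sym _] := mpinvP A.
by apply: spectral_norm_proj; rewrite // mulmxA AXA.
Qed.

Lemma spectral_norm_mpinvl m n (A : 'M[R]_(m, n)) :
  spectral_norm (mpinv A *m A) <= 1.
Proof.
have [_ XAX _ sym] := mpinvP A.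
by apply: spectral_norm_proj; rewrite // mulmxA XAX.
Qed.

(** [P] and [Q] abstract the row and column selections, [W], [S] and [V] the
    factors of an approximation of [A]. The full-rank hypotheses let [W S V^T]
    be recovered from its selected rows and from its selected columns; the five
    terms of the error then come from the identity stated above. The projections
    [U U^+] and [U^+ U] cost a factor 1, which is why [mpinv U] enters only the
    quadratic part. *)
Lemma cur_error m n p q r (A : 'M[R]_(m, n)) (P : 'M[R]_(p, m))
    (Q : 'M[R]_(n, q)) (W : 'M[R]_(m, r)) (S : 'M[R]_r)
    (V : 'M[R]_(n, r)) :
    spectral_norm P <= 1 -> spectral_norm Q <= 1 ->
    spectral_norm W <= 1 -> spectral_norm V <= 1 ->
    row_full (P *m W) -> row_full (Q^T *m V) ->
  let U := P *m A *m Q in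
  let Delta := fnorm (A - W *m S *m V^T) in
  let nW := spectral_norm (mpinv (P *m W)) in
  let nV := spectral_norm (mpinv (Q^T *m V)) in
  (fnorm (A - A *m Q *m mpinv U *m (P *m A)) <=
     (nW + nV + 3 * nW * nV + 1) * Delta
     + (nW + nV + nW * nV + 1) * spectral_norm (mpinv U) * Delta ^+ 2 : Prop).
Proof.
move=> P1 Q1 W1 V1 PWf QVf U Delta nW nV.
have nW0 : 0 <= nW by exact: spectral_norm_ge0.
have nV0 : 0 <= nV by exact: spectral_norm_ge0.
have D0 : 0 <= Delta by exact: fnorm_ge0.
pose B := W *m S *m V^T; pose E : 'M[R]_(m, n) := A - B.
pose L := W *m mpinv (P *m W); pose K := (mpinv (Q^T *m V))^T *m V^T.
have LPB : L *m P *m B = B.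
  rewrite /L /B !mulmxA -(mulmxA W) -(mulmxA W) -(mulmxA _ P).
  by rewrite mpinv_mul_full // mulmx1.
have BQK : B *m Q *m K = B.
  rewrite /K /B !mulmxA -(mulmxA _ Q) -(mulmxA _ V^T).
  have -> : V^T *m (Q *m (mpinv (Q^T *m V))^T) = 1%:M.
    apply: trmx_inj; rewrite !trmx_mul !trmxK trmx1 -mulmxA.
    exact: mpinv_mul_full.
  by rewrite mulmx1.
have AE : A = B + E by rewrite /E addrC subrK.
have Ln : spectral_norm L <= nW by rewrite -[nW]mul1r; apply: spectral_normM_le.
have Kn : spectral_norm K <= nV.
  rewrite -[nV]mulr1; apply: spectral_normM_le; rewrite spectral_norm_tr //.
have DE : fnorm E <= Delta by [].
(* From here on [B], [L] and [K] act as atoms, so that reassociating products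
   does not break them up. *)
clearbody E L K B.
pose F := P *m E *m Q.
have UF : U = P *m B *m Q + F by rewrite /U {1}AE mulmxDr mulmxDl.
have Fn : fnorm F <= Delta.
  rewrite -[Delta]mulr1; apply: fnorm_mulr_le => //.
  by rewrite -[Delta]mul1r; apply: fnorm_mull_le.
pose E1 : 'M[R]_(m, q) := E *m Q - L *m F.
pose E2 : 'M[R]_(p, n) := P *m E - F *m K.
(* [U X U = U] is what makes the error-free parts cancel. *)
have [UXU _ _ _] := mpinvP U.
clearbody U F.
have CE : A *m Q = L *m U + E1.
  rewrite {1}AE UF mulmxDl mulmxDr !mulmxA LPB -addrA; congr (_ + _).
  by rewrite /E1 addrC subrK.
have RE : P *m A = U *m K + E2.
  rewrite {1}AE UF mulmxDl mulmxDr -{1}BQK !mulmxA -addrA; congr (_ + _).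
  by rewrite /E2 addrC subrK.
have AE' : A = L *m U *m K + (E - L *m F *m K).
  rewrite {1}AE UF mulmxDr mulmxDl !mulmxA LPB BQK -addrA; congr (_ + _).
  by rewrite addrC subrK.
have E1n : fnorm E1 <= (1 + nW) * Delta.
  rewrite mulrDl mul1r; apply: fnormB_le.
    by rewrite -[Delta]mulr1; apply: fnorm_mulr_le.
  exact: fnorm_mull_le.
have E2n : fnorm E2 <= (1 + nV) * Delta.
  rewrite mulrDl mul1r; apply: fnormB_le.
    by rewrite -[Delta]mul1r; apply: fnorm_mull_le.
  by rewrite mulrC; apply: fnorm_mulr_le.
have prodE : A *m Q *m mpinv U *m (P *m A) =
    L *m U *m K + (L *m (U *m mpinv U) *m E2 + (E1 *m (mpinv U *m U *m K)
    + E1 *m mpinv U *m E2)).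
  rewrite CE RE !(mulmxDl, mulmxDr) !mulmxA.
  by rewrite -(mulmxA L U) -(mulmxA L _ U) UXU addrACA -!addrA.
have -> : A - A *m Q *m mpinv U *m (P *m A) =
    E - L *m F *m K - L *m (U *m mpinv U) *m E2 - E1 *m (mpinv U *m U *m K)
    - E1 *m mpinv U *m E2.
  by rewrite prodE {1}AE' opprD addrACA subrr add0r !opprD !addrA.
set u := spectral_norm (mpinv U).
have u0 : 0 <= u by exact: spectral_norm_ge0.
(* The bound, regrouped as one summand for each of the five terms. *)
have -> : (nW + nV + 3 * nW * nV + 1) * Delta
    + (nW + nV + nW * nV + 1) * u * Delta ^+ 2 =
    Delta + nW * Delta * nV + nW * 1 * ((1 + nV) * Delta)
    + ((1 + nW) * Delta) * (1 * nV)
    + ((1 + nW) * Delta * u * ((1 + nV) * Delta)) by ring.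
apply: fnormB_le; first apply: fnormB_le; first apply: fnormB_le;
  first apply: fnormB_le => //.
- by apply: fnorm_mulr_le Kn; apply: fnorm_mull_le.
- apply: fnorm_mull_le => //; apply: spectral_normM_le => //.
  exact: spectral_norm_mpinvr.
- apply: fnorm_mulr_le => //; apply: spectral_normM_le => //.
  exact: spectral_norm_mpinvl.
- apply: le_trans (fnorm_mulmx _ _) _.
  by rewrite ler_pM ?fnorm_ge0//; apply: fnorm_mulr_le.
Qed.

End CURError.

(** * Selecting rows and columns *)

Section Selections.
Variable R : realType.

(** The rows of such a matrix are distinct rows of the identity, hence
    orthonormal: its transpose is an isometry. *)
Lemma spectral_norm_rowsub m n (f : 'I_m -> 'I_n) :
  injective f -> spectral_norm (rowsub f 1%:M : 'M[R]_(m, n)) <= 1.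
Proof.
move=> f_inj; rewrite -spectral_norm_tr; apply: spectral_norm_isometry.
rewrite trmxK mul_rowsub_mx mul1mx; apply/matrixP => i j.
by rewrite !mxE (inj_eq f_inj) eq_sym.
Qed.

Lemma rows_ofE m n (I : {set 'I_m}) (A : 'M[R]_(m, n)) :
  rows_of I A = rows_of I 1%:M *m A.
Proof. by rewrite /rows_of rowsubE. Qed.

Lemma cols_of_tr m n (J : {set 'I_n}) (A : 'M[R]_(m, n)) :
  (cols_of J A)^T = rows_of J A^T.
Proof. by apply/matrixP => i j; rewrite !mxE. Qed.

Lemma cols_ofE m n (J : {set 'I_n}) (A : 'M[R]_(m, n)) :
  cols_of J A = A *m (rows_of J 1%:M)^T.
Proof. by apply: trmx_inj; rewrite cols_of_tr rows_ofE trmx_mul trmxK. Qed.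

Lemma spectral_norm_rows_of1 m (I : {set 'I_m}) :
  spectral_norm (rows_of I (1%:M : 'M[R]_m)) <= 1.
Proof. exact/spectral_norm_rowsub/enum_val_inj. Qed.

Lemma spectral_norm_first_cols n r (h : (r <= n)%N) (W : 'M[R]_n) :
  orthogonal_mx W -> spectral_norm (first_cols h W) <= 1.
Proof.
move=> WW; apply: spectral_norm_isometry.
apply/matrixP => i j; have /matrixP/(_ (widen_ord h i) (widen_ord h j)) := WW.
rewrite !mxE -(inj_eq val_inj) /= => <-.
by apply: eq_bigr => k _; rewrite !mxE.
Qed.

End Selections.

(** * Successive mode products *)

Section ModeProducts.
Variables (R : realType) (N : nat).

(** Distributivity of a product over sums, when each factor has its own index
    type. It reduces to families over the disjoint union of these types whose
    i-th entry carries the tag [i]. *)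
Lemma prodr_sum_dffun (I : finType) (T_ : I -> finType)
    (F : forall i, T_ i -> R) :
  \prod_i \sum_(j : T_ i) F i j =
  \sum_(k : {dffun forall i, T_ i}) \prod_i F i (k i).
Proof.
rewrite (reindex (@dffun_of_fprod _ T_)) /=; last first.
  exact/onW_bij/dffun_of_fprod_bij.
under eq_bigr => i _ do rewrite (big_tag F).
rewrite bigA_distr_big_dep.
pose P_ i := [ffun j => F i j].
transitivity (\sum_(g in family (tagged_with T_)) \prod_i untag 0 (P_ i) (g i)).
  apply: eq_bigr => g _; apply: eq_bigr => i _; rewrite /untag.
  by case: eqP => // e; rewrite ffunE.
rewrite -big_fprod; apply: eq_bigr => t _; apply: eq_bigr => i _.
by rewrite !ffunE.
Qed.

Lemma prod_delta (p : 'I_N -> nat) (i k : mindex p) :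
  \prod_n ((i n == k n)%:R : R) = (i == k)%:R.
Proof.
have [->|ik] := eqVneq i k; first by apply: big1 => n _; rewrite eqxx.
have [n nik] : exists n, i n != k n.
  apply/existsP; rewrite -negb_forall; apply: contra ik => /forallP ik.
  by apply/eqP/ffunP => n; apply/eqP.
by rewrite (bigD1 n) //= (negPf nik) mul0r.
Qed.

Lemma eq_modeprods (p q : 'I_N -> nat) (T : tensor R q)
    (A B : forall n, 'M[R]_(p n, q n)) :
  (forall n, A n = B n) -> modeprods T A = modeprods T B.
Proof.
move=> AB; apply/ffunP => i; rewrite !modeprodsE.
by apply: eq_bigr => k _; under eq_bigr do rewrite AB.
Qed.

(** The entry formula of [modeprods] turns composition into a sum over the
    intermediate multi-index, which factors over the modes by
    [prodr_sum_dffun]. *)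
Lemma modeprods_comp (p q s : 'I_N -> nat) (T : tensor R s)
    (A : forall n, 'M[R]_(q n, s n)) (B : forall n, 'M[R]_(p n, q n)) :
  modeprods (modeprods T A) B = modeprods T (fun n => B n *m A n).
Proof.
apply/ffunP => i; rewrite !modeprodsE.
under eq_bigr => k _ do rewrite modeprodsE mulr_suml.
rewrite exchange_big; apply: eq_bigr => l _ /=.
under eq_bigr => k _ do rewrite -mulrA -big_split /=.
rewrite -mulr_sumr; congr (_ * _).
rewrite -(prodr_sum_dffun (fun n x => A n x (l n) * B n (i n) x)).
apply: eq_bigr => n _; rewrite mxE.
by apply: eq_bigr => x _; rewrite mulrC.
Qed.

(** Multiplying by 0-1 matrices with a single 1 in each row only moves entries
    around; this covers both the identity and the restriction to index sets. *)
Lemma modeprods_gather (p q : 'I_N -> nat) (T : tensor R q)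
    (f : forall n, 'I_(p n) -> 'I_(q n)) (i : mindex p) :
  modeprods T (fun n => rowsub (f n) 1%:M) i = T [ffun n => f n (i n)].
Proof.
pose j : mindex q := [ffun n => f n (i n)].
rewrite modeprodsE -/j (bigD1 j) //= addrC big1 => [|k ki].
  rewrite add0r big1 ?mulr1// => n _.
  by rewrite !mxE ffunE eqxx.
have -> : \prod_n rowsub (f n) 1%:M (i n) (k n) = \prod_n (j n == k n)%:R :> R.
  by apply: eq_bigr => n _; rewrite !mxE ffunE.
by rewrite prod_delta eq_sym (negPf ki) mulr0.
Qed.

Lemma modeprods1 (p : 'I_N -> nat) (T : tensor R p) :
  modeprods T (fun n => 1%:M) = T.
Proof.
apply/ffunP => i.
rewrite (eq_modeprods T (B := fun n => rowsub id 1%:M)) ?modeprods_gather.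
  by congr (T _); apply/ffunP => n; rewrite ffunE.
by move=> n; apply/matrixP => a b; rewrite !mxE.
Qed.

Lemma subtensorE (p : 'I_N -> nat) (I : forall n, {set 'I_(p n)})
    (T : tensor R p) :
  subtensor I T = modeprods T (fun n => rows_of (I n) 1%:M).
Proof. by apply/ffunP => k; rewrite modeprods_gather ffunE. Qed.

Lemma modeprodsB (p q : 'I_N -> nat) (T T' : tensor R q)
    (A : forall n, 'M[R]_(p n, q n)) :
  modeprods (T - T') A = modeprods T A - modeprods T' A.
Proof.
apply/ffunP => i; rewrite [RHS]ffunE [X in _ = _ + X]ffunE !modeprodsE -sumrB.
apply: eq_bigr => k _; by rewrite !ffunE mulrBl.
Qed.

End ModeProducts.

(** * Unfoldings and one-mode products *)

Section Unfoldings.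
Variables (R : realType) (N : nat) (d : 'I_N -> nat).
Local Notation index := (mindex (fun m => (d m).+1)).
Local Notation tensor := (tensor R (fun m => (d m).+1)).
Local Notation modemx := (forall n, 'M[R]_((d n).+1)).

(** Column numbers of an unfolding are written in a mixed radix system with one
    digit for each mode other than [n]. By induction on [p], the digits of the
    modes below [p] determine the number modulo the product of their radices;
    for [p = N] this product exceeds the number. *)
Lemma mixed_radix_inj (n : 'I_N) (j j' : nat) :
    (j < unfold_cols d n)%N -> (j' < unfold_cols d n)%N ->
    (forall m : 'I_N, m != n ->
       j %/ unfold_stride d n m = j' %/ unfold_stride d n m %[mod (d m).+1]) ->
  j = j'.
Proof.
move=> jlt j'lt digits.
pose s p := (\prod_(k < N | (k < p)%N && (k != n)) (d k).+1)%N.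
have modE p : (p <= N)%N -> j = j' %[mod s p].
  elim: p => [|p IH] pN; first by rewrite /s big1 ?modn1 // => i /andP[].
  pose m := Ordinal pN; have {}IH := IH (ltnW pN).
  have [mn|mn] := eqVneq m n.
    suff -> : s p.+1 = s p by [].
    apply: eq_bigl => k; rewrite ltnS leq_eqVlt andb_orl.
    have [kp|//] := eqVneq (k : nat) p.
    have kn : k = n by rewrite -mn; apply: ord_inj.
    by rewrite kn eqxx andbF.
  (* Mode [m] contributes a new leading digit. *)
  have sS : s p.+1 = ((d m).+1 * s p)%N.
    rewrite /s (bigD1 m) /=; last by rewrite ltnSn mn.
    congr (_ * _)%N; apply: eq_bigl => k.
    by rewrite ltnS andbC andbA ltn_neqAle -(inj_eq val_inj).
  have digitE (l : nat) :
      (l %% s p.+1 = l %/ s p %% (d m).+1 * s p + l %% s p)%N.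
    rewrite [LHS](divn_eq _ (s p)) sS modn_divl.
    by rewrite (@modn_dvdm ((d m).+1 * s p)) // dvdn_mull.
  by rewrite !digitE IH (digits m mn).
have := modE N (leqnn N).
suff -> : s N = unfold_cols d n by rewrite !modn_small.
by apply: eq_bigl => k; rewrite ltn_ord.
Qed.

Lemma unfold_index_in (n : 'I_N) (i : 'I_(d n).+1) (j : nat) :
  (unfold_index i j : index) n = i.
Proof. by rewrite ffunE dfwithin. Qed.

Lemma unfold_index_out (n m : 'I_N) (i : 'I_(d n).+1) (j : nat) :
  m != n -> (unfold_index i j : index) m = inZp (j %/ unfold_stride d n m).
Proof. by move=> mn; rewrite ffunE dfwithout // eq_sym. Qed.

(** Injectivity is the uniqueness of the digits, and both sides have the same
    cardinality. *)
Lemma unfold_index_bij (n : 'I_N) :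
  bijective (fun p : 'I_(d n).+1 * 'I_(unfold_cols d n) =>
               unfold_index p.1 p.2 : index).
Proof.
apply: inj_card_bij => [[i j] [i' j'] /= /ffunP eq_ij|].
  have := eq_ij n; rewrite !unfold_index_in => ->; congr (_, _).
  apply: ord_inj; apply: (mixed_radix_inj (ltn_ord j) (ltn_ord j')) => m mn.
  have := eq_ij m; rewrite !unfold_index_out// => /(congr1 val) /=; exact.
rewrite -(bij_eq_card (@dffun_of_fprod_bij _ (fun m => 'I_(d m).+1))).
rewrite card_fprod card_prod !card_ord.
under eq_bigr do rewrite card_ord.
by rewrite (bigD1 n).
Qed.

Lemma fnorm_unfold (n : 'I_N) (T : tensor) : fnorm (unfold n T) = tnorm T.
Proof.
rewrite /fnorm /tnorm pair_big (reindex _ (onW_bij _ (unfold_index_bij n))).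
by congr Num.sqrt; apply: eq_bigr => p _; rewrite mxE.
Qed.

Definition one_mode (n : 'I_N) (B : 'M[R]_((d n).+1)) : modemx :=
  dfwith (T := fun m => 'M[R]_((d m).+1)) (fun m => 1%:M) n B.

(** Two entries of the tensor interact only if their multi-indices agree outside
    mode [n], that is, if they lie in the same column of the unfolding: for
    distinct columns [j] and [j'], some identity factor vanishes. *)
Lemma unfold_one_mode (n : 'I_N) (B : 'M[R]_((d n).+1)) (T : tensor) :
  unfold n (modeprods T (one_mode B)) = B *m unfold n T.
Proof.
apply/matrixP => i j; rewrite !mxE modeprodsE.
rewrite (reindex _ (onW_bij _ (unfold_index_bij n))).
rewrite -(pair_bigA _ (fun (i' : 'I_(d n).+1) (j' : 'I_(unfold_cols d n)) =>
  T (unfold_index i' j') *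
  \prod_m one_mode B m (unfold_index i j m) (unfold_index i' j' m))) /=.
apply: eq_bigr => i' _; rewrite mxE (bigD1 j) //= [X in _ + X]big1 => [|j' jj'].
  rewrite addr0 mulrC (bigD1 n) //= !unfold_index_in [one_mode B n]dfwithin.
  rewrite big1 ?mulr1// => m mn.
  by rewrite !unfold_index_out// /one_mode dfwithout 1?eq_sym// !mxE eqxx.
have [m mn neq] : exists2 m, m != n &
    (unfold_index i j : index) m != (unfold_index i j' : index) m.
  apply/exists_inP; apply: contra_neqT jj' => /exists_inPn eqm.
  apply: ord_inj; apply: (mixed_radix_inj (ltn_ord j') (ltn_ord j)) => m mn.
  have := eqm m mn; rewrite negbK => /eqP/(congr1 val).
  by rewrite !unfold_index_out// => ->.
rewrite (bigD1 m) //= [one_mode B m]dfwithout 1?eq_sym// !mxE.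
move: neq; rewrite !unfold_index_out// => /negPf ->.
by rewrite mul0r mulr0.
Qed.

Lemma tnorm_one_mode (n : 'I_N) (B : 'M[R]_((d n).+1)) (T : tensor) :
  tnorm (modeprods T (one_mode B)) <= spectral_norm B * tnorm T.
Proof. by rewrite -!(fnorm_unfold n) unfold_one_mode fnorm_mull. Qed.

(** The interpolation between the identity ([p = 0]) and [B] ([p = N]) along
    which the error telescopes. *)
Definition modes_below (p : nat) (B : modemx) : modemx :=
  fun m => if (m < p)%N then B m else 1%:M.

(** Mode [n] can be processed after the lower modes, or before them: products
    along different modes commute. The first form bounds the norm by induction,
    the second one exhibits the residual of mode [n] inside the telescoping
    sum. *)
Lemma modes_belowSl (n : 'I_N) (B : modemx) (T : tensor) :
  modeprods T (modes_below n.+1 B) =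
  modeprods (modeprods T (modes_below n B)) (one_mode (B n)).
Proof.
rewrite modeprods_comp; apply: eq_modeprods => m.
rewrite /modes_below /one_mode ltnS leq_eqVlt.
have [mn|mn] := eqVneq m n.
  by rewrite mn eqxx ltnn dfwithin mulmx1.
by rewrite (inj_eq (@ord_inj N)) (negPf mn) dfwithout 1?eq_sym// mul1mx.
Qed.

Lemma modes_belowSr (n : 'I_N) (B : modemx) (T : tensor) :
  modeprods T (modes_below n.+1 B) =
  modeprods (modeprods T (one_mode (B n))) (modes_below n B).
Proof.
rewrite modes_belowSl !modeprods_comp; apply: eq_modeprods => m.
rewrite /modes_below /one_mode.
have [mn|mn] := eqVneq m n; first by rewrite mn ltnn mulmx1 mul1mx.
by rewrite dfwithout 1?eq_sym// mul1mx mulmx1.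
Qed.

Lemma modes_below0 (B : modemx) (T : tensor) :
  modeprods T (modes_below 0 B) = T.
Proof. by rewrite -[RHS]modeprods1; apply: eq_modeprods. Qed.

Lemma modes_below_all (B : modemx) (T : tensor) :
  modeprods T (modes_below N B) = modeprods T B.
Proof. by apply: eq_modeprods => m; rewrite /modes_below ltn_ord. Qed.

Lemma tnorm_modes_below (p : nat) (B : modemx) (T : tensor) : (p <= N)%N ->
  tnorm (modeprods T (modes_below p B)) <=
  (\prod_(m < N | (m < p)%N) spectral_norm (B m)) * tnorm T.
Proof.
elim: p => [|p IH] pN; first by rewrite big_pred0 ?modes_below0 ?mul1r.
pose n := Ordinal pN.
rewrite (modes_belowSl n) (bigD1 n) /=; last exact: ltnSn.
apply: le_trans (tnorm_one_mode _ _) _.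
rewrite -mulrA ler_wpM2l ?spectral_norm_ge0//.
apply: le_trans (IH (ltnW pN)) _.
rewrite le_eqVlt; apply/orP; left; apply/eqP; congr (_ * _).
by apply: eq_bigl => m; rewrite ltnS ltn_neqAle -(inj_eq val_inj) andbC.
Qed.

Lemma tnorm_sum (J : Type) (r : seq J) (F : J -> tensor) :
  tnorm (\sum_(k <- r) F k) <= \sum_(k <- r) tnorm (F k).
Proof.
elim/big_ind2 : _ => // [|x1 x2 y1 y2 le1 le2].
  by rewrite /tnorm big1 ?sqrtr0// => i _; rewrite ffunE expr0n.
apply: le_trans (lerD le1 le2).
apply: le_trans (l2norm_triangle _ _); rewrite /tnorm /l2norm.
by under eq_bigr do rewrite ffunE.
Qed.

(** Each telescoping difference is the residual of mode [n] alone, to which the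
    products along the lower modes are applied. *)
Lemma tnorm_sub_modeprods (B : modemx) (T : tensor) :
  tnorm (T - modeprods T B) <=
  \sum_(n < N) (\prod_(m < N | (m < n)%N) spectral_norm (B m))
               * fnorm (unfold n T - B n *m unfold n T).
Proof.
have -> : T - modeprods T B =
    \sum_(n < N) modeprods (T - modeprods T (one_mode (B n))) (modes_below n B).
  pose S p := modeprods T (modes_below p B).
  have -> : T - modeprods T B = S 0 - S N.
    by rewrite /S modes_below0 modes_below_all.
  rewrite -[LHS]opprB -(telescope_sumr S) // -sumrN big_mkord.
  by apply: eq_bigr => n _; rewrite opprB modeprodsB -modes_belowSr.
apply: le_trans (tnorm_sum _ _) _; apply: ler_sum => n _.
apply: le_trans (tnorm_modes_below _ _ (ltnW (ltn_ord n))) _.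
rewrite -(fnorm_unfold n) -unfold_one_mode le_eqVlt; apply/orP; left.
apply/eqP; congr (_ * fnorm _).
by apply/matrixP => i j; rewrite !mxE [LHS]ffunE [X in _ + X = _]ffunE.
Qed.

End Unfoldings.

Theorem theorem4p4 (R : realType) (N : nat)
  (w : 'I_N -> R -> R) (Phi : 'I_N -> nat -> {poly R})
  (d M : 'I_N -> nat) (x omega : forall n : 'I_N, 'I_(M n) -> R)
  (f : 'rV[R]_N -> R)
  (hw : forall n, weight_function (w n))
  (hPhi : forall n, orthonormal_polys (w n) (Phi n))
  (hquad : forall n, quadrature_rule (w n) (2 * d n) (x n) (omega n))
  (W : forall n : 'I_N, 'M[R]_((d n).+1))
  (Sigma : forall n : 'I_N, 'M[R]_((d n).+1, unfold_cols d n))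
  (V : forall n : 'I_N, 'M[R]_(unfold_cols d n))
  (hsvd : forall n,
     is_svd (unfold n (hyper_coef d Phi x omega f)) (W n) (Sigma n) (V n))
  (I : forall n : 'I_N, {set 'I_(d n).+1})
  (J : forall n : 'I_N, {set 'I_(unfold_cols d n)})
  (hI : forall n, (#|I n| < (d n).+1)%N)
  (hJ : forall n, (#|J n| < unfold_cols d n)%N)
  (r : 'I_N -> nat)
  (hr : forall n, (r n < minn #|I n| #|J n|)%N) :
  let A := hyper_coef d Phi x omega f in
  let G := subtensor I A in
  let C n := cols_of (J n) (unfold n A) in
  let U n := rows_of (I n) (C n) in
  let A_TCUR := modeprods G (fun n => C n *m mpinv (U n)) in
  let Wr n := first_cols (ltn_min_card_l (hr n)) (W n) in
  let Sr n :=
    leading_block (ltn_min_card_l (hr n)) (ltn_min_card_r (hr n)) (Sigma n) in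
  let Vr n := first_cols (ltn_min_card_r (hr n)) (V n) in
  let WI n := rows_of (I n) (Wr n) in
  let VJ n := rows_of (J n) (Vr n) in
  let Delta n := fnorm (unfold n A - Wr n *m Sr n *m (Vr n)^T) in
  let nW n := spectral_norm (mpinv (WI n)) in
  let nV n := spectral_norm (mpinv (VJ n)) in
  let alpha n := nW n + nV n + 3 * nW n * nV n + 1 in
  let beta n := nW n + nV n + nW n * nV n + 1 in
  (forall n, \rank (WI n) = r n) ->
  (forall n, \rank (VJ n) = r n) ->
  tnorm (A - A_TCUR) <=
    \sum_(n < N)
      (\prod_(m < N | (m < n)%N) spectral_norm (C m *m mpinv (U m)))
      * (alpha n * Delta n
         + beta n * spectral_norm (mpinv (U n)) * Delta n ^+ 2).
Proof.
move=> A G C U A_TCUR Wr Sr Vr WI VJ Delta nW nV alpha beta rkWI rkVJ.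
pose P n : 'M[R]_(_, (d n).+1) := rows_of (I n) 1%:M.
(* [P n] moves from the core tensor into the factor of mode [n]. *)
pose B n := C n *m mpinv (U n) *m P n.
have -> : A_TCUR = modeprods A B.
  by rewrite /A_TCUR /G subtensorE modeprods_comp.
apply: le_trans (tnorm_sub_modeprods B A) _.
apply: ler_sum => n _; apply: ler_pM; rewrite ?fnorm_ge0//.
- by apply: prodr_ge0 => m _; apply: spectral_norm_ge0.
- apply: ler_prod => m _; rewrite spectral_norm_ge0 /=.
  rewrite -[leRHS]mulr1; apply: spectral_normM_le => //.
  exact: spectral_norm_rows_of1.
have [_ Worth Vorth _ _] := hsvd n.
pose Q := (rows_of (J n) (1%:M : 'M[R]_(unfold_cols d n)))^T.
have CE : C n = unfold n A *m Q by rewrite /C cols_ofE.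
have UE : U n = P n *m unfold n A *m Q by rewrite /U rows_ofE CE mulmxA.
have WIE : WI n = P n *m Wr n by rewrite /WI rows_ofE.
have VJE : VJ n = Q^T *m Vr n by rewrite /VJ rows_ofE trmxK.
rewrite /B -mulmxA CE /alpha /beta /nW /nV /Delta UE WIE VJE.
apply: cur_error.
- exact: spectral_norm_rows_of1.
- by rewrite spectral_norm_tr; apply: spectral_norm_rows_of1.
- exact: spectral_norm_first_cols.
- exact: spectral_norm_first_cols.
- by rewrite -WIE /row_full rkWI.
- by rewrite -VJE /row_full rkVJ.
Qed.
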